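(* Let $\eta=(\eta_1,\dots,\eta_t)$ be a sequence of positive integers with sum $n$, let $R=(R_1,\dots,R_t)$ be a sequence of rectangular partitions where $R_i=(\mu_i^{\eta_i})$ has $\eta_i$ rows and $\mu_i$ columns, and let $\lambda=(\lambda_1\ge\dots\ge\lambda_n\ge 0)$ be a partition with $|\lambda|=\sum_i|R_i|$. Let $k$ be a positive integer with $k\ge\lambda_1$ and $k\ge\mu_i$ for all $i$. Put $\widetilde\lambda=(k-\lambda_n,k-\lambda_{n-1},\dots,k-\lambda_1)$ and $\widetilde R=(\widetilde R_1,\dots,\widetilde R_t)$ with $\widetilde R_i=((k-\mu_i)^{\eta_i})$. Then there is a bijection of sets of admissible configurations $$C(\lambda^t;R^t)\to C(\widetilde\lambda^t;\widetilde R^t),\qquad \nu=(\nu^1,\nu^2,\dots,\nu^{k-1},\emptyset,\dots)\mapsto\widetilde\nu=(\nu^{k-1},\nu^{k-2},\dots,\nu^1,\emptyset,\dots).$$ Furthermore, for every $1\le i\le k-1$ and $j\ge1$, $P_{i,j}(\nu)=P_{k-i,j}(\widetilde\nu)$. In particular, the bijection $\nu\mapsto\widetilde\nu$ from $C(\lambda^t;R^t)$ to $C(\widetilde\lambda^t;\widetilde R^t)$ induces a cocharge-preserving map of rigged configurations $RC(\lambda^t;R^t)\to RC(\widetilde\lambda^t;\widetilde R^t)$, $(\nu,L)\mapsto(\widetilde\nu,\widetilde L)$, where $\widetilde L^{k-p}_s=L^{p}_s$ for all $1\le p<k$ and $1\le s\le\ell(\nu^p)=\ell(\widetilde\nu^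{k-p})$.
   Context: $\lambda^t$ is the conjugate (transpose) partition; $R^t$ (resp. $\widetilde R^t$) is the sequence of transposed rectangles of $R$ (resp. $\widetilde R$), so the $i$-th member of $R^t$ has $\mu_i$ rows and $\eta_i$ columns and the $i$-th member of $\widetilde R^t$ has $k-\mu_i$ rows and $\eta_i$ columns (rectangles with zero rows are empty and contribute nothing). $\ell(\rho)$ is the number of nonzero parts of $\rho$. The following definitions are for a general type $(\lambda;R)$: $\lambda$ a partition and $R=(R_1,R_2,\dots)$ a finite sequence of rectangular partitions, $R_a$ having $\eta_a$ rows and $\mu_a$ columns, with $|\lambda|=\sum_a|R_a|$. (For the types used in the claim, $\eta_a,\mu_a$ must be replaced by the row and column numbers of the rectangles concerned.) A configuration of type $(\lambda;R)$ is a sequence of partitions $\nu=(\nu^1,\nu^2,\dots)$ with $|\nu^i|=\sum_{j>i}\lambda_j-\sum_a\mu_a\max(\eta_a-i,0)$ for all $i\ge1$; by convention $\nu^0$ is the empty partition. For a partition $\rho$, $Q_m(\rho)=\rho^t_1+\dots+\rho^t_m$ is the number of cells in the first $m$ columns of $\rho$. The vacancy numbers of $\nu$ are $$P_{i,m}(\nu)=Q_m(\nu^{i-1})-2Q_m(\nu^i)+Q_m(\nu^{i+1})+\sum_a\min(\mu_a,m)\,\delta_{\eta_a,i}\qquad(i,m\ge1),$$ where $\delta$ is the Kronecker delta. $\nu$ is admissible if $P_{i,m}(\nu)\ge0$ for all $i,m\ge1$; $C(\lambda;R)$ is the set of admissible configurations of type $(\lambda;R)$. A rigging $L$ of an admissible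 configuration $\nu$ assigns an integer label $L^i_s$ to each row (part) $\nu^i_s$ such that $0\le L^i_s\le P_{i,\nu^i_s}(\nu)$ for all $i\ge1$, $1\le s\le\ell(\nu^i)$, and $L^i_s\ge L^i_{s+1}$ whenever $\nu^i_s=\nu^i_{s+1}$. $RC(\lambda;R)$ is the set of pairs $(\nu,L)$ (rigged configurations) with $\nu\in C(\lambda;R)$ and $L$ a rigging of $\nu$. With $\alpha_{i,m}=(\nu^i)^t_m$ (the size of the $m$-th column of $\nu^i$), the cocharge is $$\mathrm{cocharge}(\nu,L)=\sum_{i,m\ge1}\alpha_{i,m}(\alpha_{i,m}-\alpha_{i+1,m})+\sum_{i\ge1}\sum_{s=1}^{\ell(\nu^i)}L^i_s.$$ *)

(* Defs.v *)
From mathcomp Require Import all_boot all_order all_algebra.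
From mathcomp Require Import all_classical.

Set Implicit Arguments.
Unset Strict Implicit.
Unset Printing Implicit Defensive.

Import Order.TTheory GRing.Theory Num.Theory.

Local Open Scope classical_set_scope.
Local Open Scope ring_scope.

(* A partition is the list of its nonzero parts, so that Leibniz equality is
   equality of partitions and [size] is the number of nonzero parts. *)
Definition is_part (p : seq nat) : bool := sorted geq p && (0%N \notin p).

(* Also meaningful on a weakly decreasing sequence with trailing zeros, in which
   case the zeros are ignored and the result satisfies [is_part]. *)
Definition transpose (p : seq nat) : seq nat :=
  [seq count (fun x => (j < x)%N) p | j <- iota 0 (head 0%N p)].

(* A rectangle may have no rows or no columns; it is then empty. *)
Record rect : Type := Rect { rows : nat; cols : nat }.

Definition transpose_rect (r : rect) : rect := Rect (cols r) (rows r).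

Definition compl_rect (k : nat) (r : rect) : rect := Rect (rows r) (k - cols r).

(* Entrywise complement in k, in reverse order; trailing zeros are kept. *)
Definition compl_seq (k : nat) (s : seq nat) : seq nat :=
  [seq (k - x)%N | x <- rev s].

Definition rc_type (lam : seq nat) (R : seq rect) : Prop :=
  is_part lam /\ sumn lam = (\sum_(r <- R) rows r * cols r)%N.

(* nu i is the i-th partition of the configuration, for i >= 1; the entry at 0
   is the conventional nu^0. The natural-number subtraction [rows r - i] is
   truncated, i.e. it is max(rows r - i, 0). *)
Definition configuration (lam : seq nat) (R : seq rect)
    (nu : nat -> seq nat) : Prop :=
  [/\ nu 0%N = [::],
      forall i, is_part (nu i) &
      forall i, (1 <= i)%N ->
        (sumn (nu i))%:Z =
        (sumn (drop i lam))%:Z - \sum_(r <- R) (cols r * (rows r - i))%:Z].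

Definition Qcells (m : nat) (rho : seq nat) : nat := sumn (take m (transpose rho)).

Definition vacancy (R : seq rect) (nu : nat -> seq nat) (i m : nat) : int :=
  (Qcells m (nu i.-1))%:Z - 2 * (Qcells m (nu i))%:Z + (Qcells m (nu i.+1))%:Z
  + \sum_(r <- R) (minn (cols r) m * (rows r == i))%:Z.

Definition admissible (R : seq rect) (nu : nat -> seq nat) : Prop :=
  forall i m, (1 <= i)%N -> (1 <= m)%N -> 0 <= vacancy R nu i m.

Definition admissible_configs (lam : seq nat) (R : seq rect) :
    set (nat -> seq nat) :=
  [set nu | configuration lam R nu /\ admissible R nu].

(* L i lists the labels of the rows of nu i, numbered from 0. *)
Definition rigging (R : seq rect) (nu : nat -> seq nat)
    (L : nat -> seq int) : Prop :=
  [/\ forall i, size (L i) = size (nu i),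
      forall i s, (1 <= i)%N -> (s < size (nu i))%N ->
        0 <= nth 0 (L i) s <= vacancy R nu i (nth 0%N (nu i) s) &
      forall i s, (1 <= i)%N -> (s.+1 < size (nu i))%N ->
        nth 0%N (nu i) s = nth 0%N (nu i) s.+1 ->
        nth 0 (L i) s.+1 <= nth 0 (L i) s].

Definition rigged_configs (lam : seq nat) (R : seq rect) :
    set ((nat -> seq nat) * (nat -> seq int)) :=
  [set x | admissible_configs lam R x.1 /\ rigging R x.1 x.2].

(* Size of the m-th column of nu i, for m >= 1. *)
Definition column (nu : nat -> seq nat) (i m : nat) : nat :=
  nth 0%N (transpose (nu i)) m.-1.

(* The index sets are infinite; all these sums have finite support when x is a
   rigged configuration. *)
Definition cocharge (x : (nat -> seq nat) * (nat -> seq int)) : int :=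
  \sum_(i \in [set i : nat | (1 <= i)%N]) \sum_(m \in [set m : nat | (1 <= m)%N])
     (column x.1 i m)%:Z * ((column x.1 i m)%:Z - (column x.1 i.+1 m)%:Z)
  + \sum_(i \in [set i : nat | (1 <= i)%N]) \sum_(l <- x.2 i) l.

(* (x^1, x^2, ...) |-> (x^(k-1), ..., x^1, [::], [::], ...), with [::] at 0. *)
Definition reverse_levels (T : Type) (k : nat) (x : nat -> seq T) : nat -> seq T :=
  fun i => if (0 < i < k)%N then x (k - i)%N else [::].

(* Main.v *)
Require Import Defs.
From mathcomp Require Import all_boot all_order all_algebra.
From mathcomp Require Import all_classical.
From mathcomp Require Import zify ring.

Set Implicit Arguments.
Unset Strict Implicit.
Unset Printing Implicit Defensive.

Import Order.TTheory GRing.Theory Num.Theory.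

Local Open Scope classical_set_scope.
Local Open Scope ring_scope.

(** Counting cells row by row, the prescribed size of nu^i is
    sum_r max(lambda_r - i, 0) - sum_a eta_a max(mu_a - i, 0).
    Since max(x, 0) - max(-x, 0) = x, replacing lambda, mu, i by their
    complements in k changes both sums by linear terms, and these cancel because
    |lambda| = |R| and sum_a eta_a = n. The sizes vanish for i >= k, so every
    configuration is supported on the levels 1, ..., k - 1. The vacancy numbers
    are symmetric in the levels i - 1 and i + 1, and mu_a = i iff
    k - mu_a = k - i; hence they are preserved by the reversal of levels. The
    quadratic part of the cocharge is preserved because alpha_{0,m} and
    alpha_{k,m} vanish. *)

(** * Transposes of weakly decreasing sequences *)

Lemma geq_trans : transitive geq.
Proof. by move=> y x z xy yz; apply: leq_trans yz xy. Qed.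

Lemma sorted_le_head (p : seq nat) (x : nat) :
  sorted geq p -> x \in p -> (x <= head 0%N p)%N.
Proof.
case: p => //= y p /(order_path_min geq_trans)/allP yp.
by rewrite inE => /orP[/eqP->|/yp].
Qed.

Lemma is_part_transpose (p : seq nat) : sorted geq p -> is_part (transpose p).
Proof.
move=> sp; apply/andP; split.
  apply: (homo_sorted (e := leq)); last exact: iota_sorted.
  by move=> i j ij; apply: sub_count => x /=; apply: leq_ltn_trans.
apply/negP => /mapP[j]; rewrite mem_iota add0n => jp.
by case: p jp {sp} => //= x p ->.
Qed.

(** Double counting of the cells to the right of the first [i] columns, once by columns and once by
    rows. *)
Lemma sumn_drop_transpose (p : seq nat) (i : nat) :
  sorted geq p ->
  sumn (drop i (transpose p)) = (\sum_(x <- p) (x - i))%N.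
Proof.
move=> sp; rewrite /transpose -map_drop drop_iota add0n sumnE big_map.
under eq_bigr do rewrite -sum1_count big_mkcond.
rewrite exchange_big /= big_seq [RHS]big_seq; apply: eq_bigr => x xp.
(* No part exceeds the head, so the condition [j < x] cuts the range of columns down to i <= j <
   x. *)
rewrite -big_mkcond /= -(big_nat_widen _ _ _ xpredT) ?sorted_le_head //.
by rewrite sum_nat_const_nat muln1.
Qed.

Lemma sumn_transpose (p : seq nat) :
  sorted geq p -> sumn (transpose p) = sumn p.
Proof.
move=> sp; rewrite -[transpose p]drop0 sumn_drop_transpose // sumnE.
by under eq_bigr do rewrite subn0.
Qed.

Lemma nth_transpose_oversize (p : seq nat) (m : nat) :
  (head 0%N p <= m)%N -> nth 0%N (transpose p) m = 0%N.
Proof. by move=> pm; rewrite nth_default // size_map size_iota. Qed.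

(** * Complementation in [k] and the prescribed sizes *)

(* The hypotheses of the theorem in a form stable under complementation in k, so
   that each lemma also applies to the complementary data. *)
Definition fits (k : nat) (lam : seq nat) (R : seq rect) : Prop :=
  [/\ sorted geq lam, all (leq^~ k) lam, all (fun r => (cols r <= k)%N) R,
      size lam = (\sum_(r <- R) rows r)%N &
      sumn lam = (\sum_(r <- R) rows r * cols r)%N].

Lemma sorted_compl_seq (k : nat) (s : seq nat) :
  sorted geq s -> sorted geq (compl_seq k s).
Proof.
move=> ss; apply: (homo_sorted (e := leq)).
  by move=> x y xy /=; apply: leq_sub2l.
by rewrite rev_sorted.
Qed.

Lemma compl_seqK (k : nat) (s : seq nat) :
  all (leq^~ k) s -> compl_seq k (compl_seq k s) = s.
Proof.
move=> /allP sk; rewrite /compl_seq -map_rev revK -map_comp.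
by rewrite -[RHS]map_id; apply/eq_in_map => x /sk /= /subKn.
Qed.

Lemma compl_rectK (k : nat) (R : seq rect) :
  all (fun r => (cols r <= k)%N) R ->
  map (compl_rect k) (map (compl_rect k) R) = R.
Proof.
elim: R => //= -[a b] R IH /= /andP[bk /IH ->].
by rewrite /compl_rect /= subKn.
Qed.

(* The prescribed size of the i-th partition of a configuration of transposed
   type, read off the rows of lam and R. *)
Definition excess (lam : seq nat) (R : seq rect) (i : nat) : int :=
  (\sum_(x <- lam) (x - i))%N%:Z - (\sum_(r <- R) rows r * (cols r - i))%N%:Z.

Lemma excess_oversize (k : nat) (lam : seq nat) (R : seq rect) (i : nat) :
  fits k lam R -> (k <= i)%N -> excess lam R i = 0.
Proof.
move=> [_ /allP lamk Rk _ _] ki; rewrite /excess big_seq big1 => [|x /lamk xk].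
  rewrite sub0r; elim: R Rk => [|r R IH] /=; rewrite ?big_nil // big_cons.
  move=> /andP[rk /IH]; have /eqP-> : (cols r - i == 0)%N by lia.
  by rewrite muln0.
by apply/eqP; rewrite subn_eq0 (leq_trans xk).
Qed.

Lemma excess_compl (k : nat) (lam : seq nat) (R : seq rect) (i : nat) :
  fits k lam R -> (i <= k)%N ->
  excess (compl_seq k lam) (map (compl_rect k) R) i = excess lam R (k - i).
Proof.
move=> [_ lamk Rk slam lamR] ik.
(* Termwise, max(k - x - i, 0) + x = max(x - (k - i), 0) + (k - i) for x, i <= k; [sumR] is the same
   identity weighted by [rows r]. *)
have sumL : ((\sum_(x <- compl_seq k lam) (x - i)) + sumn lam
   = \sum_(x <- lam) (x - (k - i)) + size lam * (k - i))%N.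
  rewrite big_map big_rev /= {slam lamR}.
  elim: lam lamk => [|x l IH] /=; rewrite ?big_nil // !big_cons.
  by move=> /andP[xk /IH]; nia.
have sumR : (\sum_(r <- map (compl_rect k) R) rows r * (cols r - i)
     + \sum_(r <- R) rows r * cols r
   = \sum_(r <- R) rows r * (cols r - (k - i))
     + (\sum_(r <- R) rows r) * (k - i))%N.
  rewrite big_map /= {slam lamR}.
  elim: R Rk => [|[a b] l IH] /=; rewrite ?big_nil // !big_cons /=.
  move=> /andP[bk /IH] E.
  have : (k - b - i + b = b - (k - i) + (k - i))%N by lia.
  move=> /(congr1 (muln a)); rewrite !mulnDr mulnDl; lia.
by rewrite /excess; lia.
Qed.

(** The equality of sizes is the case i = 0 of [excess_compl]: the excess at 0 is the difference of
    the two sizes, and it equals the original excess at [k], which vanishes. *)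
Lemma fits_compl (k : nat) (lam : seq nat) (R : seq rect) :
  fits k lam R -> fits k (compl_seq k lam) (map (compl_rect k) R).
Proof.
move=> fitsR; have := excess_compl fitsR (leq0n k).
rewrite subn0 (excess_oversize fitsR) // /excess.
under eq_bigr do rewrite subn0.
under [X in _ - X%:Z = _]eq_bigr do rewrite subn0.
rewrite -sumnE => sumE; case: fitsR => slam lamk Rk slamR lamR; split.
- exact: sorted_compl_seq.
- by apply/allP => _ /mapP[x _ ->]; apply: leq_subr.
- by rewrite all_map; elim: (R) => //= r s ->; rewrite leq_subr.
- by rewrite size_map size_rev slamR big_map.
- by move/subr0_eq: sumE => [].
Qed.

Lemma rc_type_transpose (k : nat) (lam : seq nat) (R : seq rect) :
  fits k lam R -> rc_type (transpose lam) (map transpose_rect R).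
Proof.
case=> slam _ _ _ lamR; split; first exact: is_part_transpose.
rewrite sumn_transpose // lamR big_map.
by apply: eq_bigr => r _; rewrite mulnC.
Qed.

Lemma excess_transpose (lam : seq nat) (R : seq rect) (i : nat) :
  sorted geq lam ->
  (sumn (drop i (transpose lam)))%:Z
    - \sum_(r <- map transpose_rect R) (cols r * (rows r - i))%N%:Z
  = excess lam R i.
Proof.
move=> slam; rewrite sumn_drop_transpose // big_map /excess; congr (_ - _).
by rewrite (big_morph Posz PoszD (erefl _)).
Qed.

(** The prescribed size is zero from level [k] on, and a list of nonzero parts with sum zero is
    empty. *)
Lemma admissible_configs_nil (k : nat) (lam : seq nat) (R : seq rect)
    (nu : nat -> seq nat) (i : nat) :
  fits k lam R ->
  admissible_configs (transpose lam) (map transpose_rect R) nu ->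
  (k <= i)%N -> nu i = [::].
Proof.
move=> fitsR [[nu0 nup nus] _] ki; have [slam _ _ _ _] := fitsR.
case: (posnP i) => [->//|i0].
move: (nus i i0); rewrite excess_transpose // (excess_oversize fitsR) //.
case: (nu i) (nup i) => [|x p] //= /andP[_]; rewrite inE negb_or => /andP[x0 _].
by lia.
Qed.

(** * Reversal of levels on admissible configurations *)

(** Emptiness at 0 and at [k] extends the formula to these two boundary levels, which enter the
    vacancy numbers at levels 1 and k - 1. *)
Lemma reverse_levelsE (T : Type) (k : nat) (x : nat -> seq T) (i : nat) :
  x 0%N = [::] -> (forall j, (k <= j)%N -> x j = [::]) -> (i <= k)%N ->
  reverse_levels k x i = x (k - i)%N.
Proof.
move=> x0 xk; rewrite leq_eqVlt /reverse_levels => /orP[/eqP->|ik].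
  by rewrite ltnn andbF subnn x0.
by rewrite ik andbT; case: (posnP i) => // ->; rewrite subn0 xk.
Qed.

Lemma reverse_levels_nil (T : Type) (k : nat) (x : nat -> seq T) (i : nat) :
  (k <= i)%N -> reverse_levels k x i = [::].
Proof. by move=> ki; rewrite /reverse_levels (ltnNge i) ki andbF. Qed.

Lemma reverse_levelsK (T : Type) (k : nat) (x : nat -> seq T) :
  x 0%N = [::] -> (forall j, (k <= j)%N -> x j = [::]) ->
  reverse_levels k (reverse_levels k x) = x.
Proof.
move=> x0 xk; apply/funext => i; rewrite {1}/reverse_levels.
case: ifPn => [/andP[i0 ik]|].
  by rewrite reverse_levelsE ?leq_subr ?subKn // ltnW.
by rewrite negb_and -leqNgt leqn0 -leqNgt => /orP[/eqP->|/xk->].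
Qed.

Lemma vacancy_reverse (k : nat) (R : seq rect) (nu : nat -> seq nat)
    (i j : nat) :
  nu 0%N = [::] -> (forall l, (k <= l)%N -> nu l = [::]) ->
  all (fun r => (cols r <= k)%N) R -> (0 < i < k)%N ->
  vacancy (map transpose_rect (map (compl_rect k) R)) (reverse_levels k nu)
    (k - i) j
  = vacancy (map transpose_rect R) nu i j.
Proof.
move=> nu0 nuk Rk /andP[i0 ik]; rewrite /vacancy !reverse_levelsE //; try lia.
have -> : (k - (k - i).-1 = i.+1)%N by lia.
have -> : (k - (k - i).+1 = i.-1)%N by lia.
have -> : (k - (k - i) = i)%N by lia.
rewrite !big_map /=; congr (_ + _); first ring.
elim: R Rk => [|r R IH] /=; rewrite ?big_nil // !big_cons => /andP[rk /IH ->].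
(* Truncated subtraction from [k] is injective on numbers at most [k]. *)
by congr (_ + _); have -> : (k - cols r == k - i)%N = (cols r == i) by lia.
Qed.

Lemma admissible_configs_reverse (k : nat) (lam : seq nat) (R : seq rect)
    (nu : nat -> seq nat) :
  fits k lam R ->
  admissible_configs (transpose lam) (map transpose_rect R) nu ->
  admissible_configs (transpose (compl_seq k lam))
    (map transpose_rect (map (compl_rect k) R)) (reverse_levels k nu).
Proof.
move=> fitsR nuA; have nuk := admissible_configs_nil fitsR nuA.
have [slam _ Rk _ _] := fitsR; have fitsR' := fits_compl fitsR.
have [slam' _ _ _ _] := fitsR'; case: nuA => [[nu0 nup nus] nuA].
split; first split=> [//|i|i i0].
- by rewrite /reverse_levels; case: ifP.
- rewrite excess_transpose //; have [ki|ik] := leqP k i.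
    by rewrite reverse_levels_nil // (excess_oversize fitsR').
  rewrite reverse_levelsE ?(ltnW ik) // (excess_compl fitsR) ?(ltnW ik) //.
  by rewrite nus ?subn_gt0 // excess_transpose.
move=> i m i0 m0; have [ki|ik] := leqP k i; last first.
  rewrite -[i](subKn (ltnW ik)) vacancy_reverse //; last by lia.
  by apply: nuA; rewrite ?subn_gt0.
(* For i >= k the only negative term, that of level i, vanishes; level i - 1 may still be nonempty
   when i = k, but contributes positively. *)
rewrite /vacancy (reverse_levels_nil nu ki) (reverse_levels_nil nu (leqW ki)).
by rewrite [Qcells m [::]]/= mulr0 subr0 !addr_ge0 // sumr_ge0.
Qed.

Lemma set_bij_reverse_levels (k : nat) (lam : seq nat) (R : seq rect) :
  fits k lam R ->
  set_bij (admissible_configs (transpose lam) (map transpose_rect R))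
    (admissible_configs (transpose (compl_seq k lam))
       (map transpose_rect (map (compl_rect k) R)))
    (reverse_levels k).
Proof.
move=> fitsR; have fitsR' := fits_compl fitsR.
have involR nu : admissible_configs (transpose lam) (map transpose_rect R) nu ->
    reverse_levels k (reverse_levels k nu) = nu.
  move=> nuA; apply: reverse_levelsK; first by case: nuA => -[].
  by move=> i; apply: admissible_configs_nil fitsR nuA.
split.
- by move=> nu /(admissible_configs_reverse fitsR).
- by move=> nu1 nu2 /set_mem/involR {2}<- /set_mem/involR {2}<- ->.
(* The preimage is again a reversal, now for the complementary data; complementing twice restores
   [lam] and [R]. *)
- move=> nu nuA; exists (reverse_levels k nu); last first.
    apply: reverse_levelsK; first by case: nuA => -[].
    by move=> i; apply: admissible_configs_nil fitsR' nuA.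
  have := admissible_configs_reverse fitsR' nuA.
  by case: fitsR => _ lamk Rk _ _; rewrite compl_seqK // compl_rectK.
Qed.

(** * Riggings *)

Lemma rigging_nil (R : seq rect) (nu : nat -> seq nat) (L : nat -> seq int)
    (i : nat) :
  rigging R nu L -> nu i = [::] -> L i = [::].
Proof. by case=> sL _ _ nui; apply/size0nil; rewrite sL nui. Qed.

(** Each rigging condition concerns a single level and its vacancy numbers, so it moves along with
    that level. *)
Lemma rigged_configs_reverse (k : nat) (lam : seq nat) (R : seq rect)
    (nu : nat -> seq nat) (L : nat -> seq int) :
  fits k lam R ->
  rigged_configs (transpose lam) (map transpose_rect R) (nu, L) ->
  rigged_configs (transpose (compl_seq k lam))
    (map transpose_rect (map (compl_rect k) R))
    (reverse_levels k nu, reverse_levels k L).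
Proof.
move=> fitsR [/= nuA [sL Lb Lw]]; split.
  exact: admissible_configs_reverse.
have nuk := admissible_configs_nil fitsR nuA.
have nu0 : nu 0%N = [::] by case: nuA => -[].
have [_ _ Rk _ _] := fitsR; split=> /=.
- by move=> i; rewrite /reverse_levels; case: ifP.
- move=> i s i0; have [ki|ik] := leqP k i; first by rewrite reverse_levels_nil.
  have -> : vacancy (map transpose_rect (map (compl_rect k) R))
      (reverse_levels k nu) i = vacancy (map transpose_rect R) nu (k - i).
    apply/funext => j; rewrite -{1}[i](subKn (ltnW ik)) vacancy_reverse //; lia.
  by rewrite /reverse_levels i0 ik /=; apply: Lb; rewrite subn_gt0.
- move=> i s i0; have [ki|ik] := leqP k i; first by rewrite reverse_levels_nil.
  by rewrite /reverse_levels i0 ik /=; apply: Lw; rewrite subn_gt0.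
Qed.

(** * Invariance of the cocharge *)

Lemma fsbig_ge1 (F : nat -> int) (N : nat) :
  (forall i, (N <= i)%N -> F i = 0) ->
  \sum_(i \in [set i : nat | (1 <= i)%N]) F i = \sum_(1 <= i < N) F i.
Proof.
move=> F0; rewrite (fsbigE (index_iota 1 N)) ?iota_uniq //.
- rewrite big_seq_cond [RHS]big_seq; apply: eq_bigl => i.
  by rewrite mem_index_iota; case: (leqP 1 i) => // i1; rewrite andbC /= mem_set.
- by move=> i /=; rewrite mem_index_iota => /andP[].
- by move=> i /= i1; rewrite mem_index_iota i1 /= -leqNgt => /F0.
Qed.

Lemma sum_rev (F : nat -> int) (k : nat) :
  \sum_(1 <= i < k) F (k - i)%N = \sum_(1 <= i < k) F i.
Proof.
rewrite big_nat_rev /= big_nat [RHS]big_nat; apply: eq_bigr => i /andP[i1 ik].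
by congr F; lia.
Qed.

(* The sums differ by the telescoping sum of [a i.+1 * a i - a i * a i.-1]. *)
Lemma sum_sqrB_rev (a : nat -> int) (k : nat) :
  a 0%N = 0 -> a k = 0 ->
  \sum_(1 <= i < k) a (k - i)%N * (a (k - i)%N - a (k - i.+1)%N)
  = \sum_(1 <= i < k) a i * (a i - a i.+1).
Proof.
(* Writing k - (i + 1) as the predecessor of k - i makes the summand a function of k - i, as
   [sum_rev] requires. *)
move=> a0 ak; under eq_bigr do rewrite subnS.
rewrite (sum_rev (fun i => a i * (a i - a i.-1))).
have [k0|k1] := posnP k; first by rewrite k0 !big_geq.
apply/eqP; rewrite -subr_eq0 -sumrB.
under eq_bigr => i _.
  rewrite (_ : _ - _ = a i.+1 * a i - a i * a i.-1); last by ring.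
  over.
rewrite /= (telescope_sumr (fun i => a i * a i.-1)) //.
by rewrite ak /= a0 mul0r mulr0 subr0.
Qed.

Lemma cocharge_reverse (k : nat) (nu : nat -> seq nat) (L : nat -> seq int) :
  nu 0%N = [::] -> (forall i, (k <= i)%N -> nu i = [::]) ->
  L 0%N = [::] -> (forall i, (k <= i)%N -> L i = [::]) ->
  cocharge (reverse_levels k nu, reverse_levels k L) = cocharge (nu, L).
Proof.
move=> nu0 nuk L0 Lk; rewrite /cocharge /=; congr (_ + _); last first.
  rewrite !(@fsbig_ge1 _ k); first last.
  - by move=> i ki; rewrite reverse_levels_nil // big_nil.
  - by move=> i ki; rewrite Lk // big_nil.
  rewrite -(sum_rev (fun i => \sum_(l <- L i) l)).
  rewrite big_nat [RHS]big_nat; apply: eq_bigr => i /andP[i1 ik].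
  by rewrite reverse_levelsE // ltnW.
(* A bound beyond all row lengths, with room for the shift from column m to list position m - 1. *)
pose M := (\max_(i < k) head 0%N (nu i)).+2.
have colM i m : (M <= m)%N -> column nu i m = 0%N.
  move=> Mm; have [ki|ik] := leqP k i; first by rewrite /column nuk //= nth_nil.
  rewrite /column nth_transpose_oversize //.
  pose h (i : 'I_k) := head 0%N (nu i).
  apply: leq_trans (leq_bigmax (F := h) (Ordinal ik)) _.
  by case: m Mm => // m /ltnW.
have col_nil i m : nu i = [::] -> column nu i m = 0%N.
  by rewrite /column => ->; rewrite nth_nil.
have colr i m : (i <= k)%N ->
    column (reverse_levels k nu) i m = column nu (k - i) m.
  by move=> ik; rewrite /column reverse_levelsE.
(* The column index is brought outside, so that [sum_sqrB_rev] applies to one column at a time. *)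
have fsum_col (rho : nat -> seq nat) :
    (forall i, (k <= i)%N -> rho i = [::]) ->
    (forall i m, (M <= m)%N -> column rho i m = 0%N) ->
  \sum_(i \in [set i : nat | (1 <= i)%N]) \sum_(m \in [set m : nat | (1 <= m)%N])
     (column rho i m)%:Z * ((column rho i m)%:Z - (column rho i.+1 m)%:Z)
  = \sum_(1 <= m < M) \sum_(1 <= i < k)
     (column rho i m)%:Z * ((column rho i m)%:Z - (column rho i.+1 m)%:Z).
  move=> rhok rhoM; rewrite (@fsbig_ge1 _ k).
    rewrite exchange_big; apply: eq_bigr => i _.
    by apply: fsbig_ge1 => m Mm; rewrite rhoM // mul0r.
  move=> i ki; apply: fsbig1 => m _.
  by rewrite {1}/column rhok //= nth_nil mul0r.
rewrite !fsum_col //; first last.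
- move=> i m Mm; have [ki|ik] := leqP k i; last by rewrite colr ?colM // ltnW.
  by rewrite /column reverse_levels_nil //= nth_nil.
- by move=> i ki; rewrite reverse_levels_nil.
apply: eq_bigr => m _.
rewrite -(@sum_sqrB_rev (fun i => (column nu i m)%:Z)) //; last first.
- by rewrite col_nil ?nuk.
- by rewrite col_nil.
rewrite big_nat [RHS]big_nat; apply: eq_bigr => i /andP[i1 ik].
by rewrite !colr // ltnW.
Qed.

Theorem proposition6 (t n k : nat) (eta mu : 'I_t -> nat) (lam : n.-tuple nat)
    (eta_gt0 : forall i, (0 < eta i)%N)
    (sum_eta : (\sum_(i < t) eta i)%N = n)
    (lam_dec : sorted geq lam)
    (size_lam : sumn lam = (\sum_(i < t) eta i * mu i)%N)
    (k_gt0 : (0 < k)%N)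
    (lam_le_k : (head 0 lam <= k)%N)
    (mu_le_k : forall i, (mu i <= k)%N) :
  let R := [seq Rect (eta i) (mu i) | i : 'I_t] in
  let lamt := transpose lam in
  let Rt := map transpose_rect R in
  let lamt' := transpose (compl_seq k lam) in
  let Rt' := map transpose_rect (map (compl_rect k) R) in
  [/\ rc_type lamt Rt /\ rc_type lamt' Rt',
      (forall nu, admissible_configs lamt Rt nu ->
         forall i, (k <= i)%N -> nu i = [::])
      /\ set_bij (admissible_configs lamt Rt) (admissible_configs lamt' Rt')
           (reverse_levels k),
      forall nu, admissible_configs lamt Rt nu ->
        forall i j, (1 <= i <= k - 1)%N -> (1 <= j)%N ->
          vacancy Rt nu i j = vacancy Rt' (reverse_levels k nu) (k - i) j &
      let F x := (reverse_levels k x.1, reverse_levels k x.2) in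
      set_fun (rigged_configs lamt Rt) (rigged_configs lamt' Rt') F
      /\ (forall x, rigged_configs lamt Rt x -> cocharge (F x) = cocharge x)].
Proof.
move=> R lamt Rt lamt' Rt'.
have fitsR : fits k lam R.
  split=> //.
  - by apply/allP => x /(sorted_le_head lam_dec) /leq_trans ->.
  - by rewrite all_map; apply/allP => i _; apply: mu_le_k.
  - by rewrite size_tuple big_map enumT.
  - by rewrite size_lam big_map enumT.
have nuk := admissible_configs_nil fitsR.
have [_ _ Rk _ _] := fitsR.
split.
- by split; apply: (@rc_type_transpose k) => //; apply: fits_compl.
- by split=> [nu /nuk //|]; apply: set_bij_reverse_levels.
- move=> nu nuA i j ik _; rewrite [RHS]vacancy_reverse //.
  + by case: nuA => -[].
  + by move=> l; apply: nuk nuA.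
  + by lia.
- move=> F; split=> -[nu L] nuL; first exact: rigged_configs_reverse.
  have [/= nuA rL] := nuL; have nu0 : nu 0%N = [::] by case: nuA => -[].
  (* A rigging has one label per row, so the label lists are empty wherever the partitions are. *)
  apply: cocharge_reverse => // [i||i] *.
  + exact: (nuk nu).
  + exact: rigging_nil rL nu0.
  + by apply: rigging_nil rL (nuk nu _ _ _).
Qed.
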